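(* Let $\alpha_3,\beta_3,\alpha_4,\beta_4$ be real numbers. The double inequalities $$A^{\alpha_{3}}(a,b)\,G^{1-\alpha_{3}}(a,b)<N_{AG}(a,b)<A^{\beta_{3}}(a,b)\,G^{1-\beta_{3}}(a,b),$$ $$\frac{\alpha_{4}}{G(a,b)}+\frac{1-\alpha_{4}}{A(a,b)}<\frac{1}{N_{AG}(a,b)}<\frac{\beta_{4}}{G(a,b)}+\frac{1-\beta_{4}}{A(a,b)}$$ hold for all $a,b>0$ with $a\neq b$ if and only if $\alpha_{3}\leq 1/3$, $\beta_{3}\geq 1$, $\alpha_{4}\leq 0$ and $\beta_{4}\geq 2/3$.
   Context: For $a,b>0$, $G(a,b)=\sqrt{ab}$ and $A(a,b)=(a+b)/2$ are the geometric and arithmetic means; $A^{p}(a,b)$ means $(A(a,b))^{p}$, and similarly for $G$. For $a,b>0$ with $a\ne b$, the Schwab-Borchardt mean is $$SB(a,b)=\begin{cases}\dfrac{\sqrt{b^2-a^2}}{\cos^{-1}(a/b)}, & a<b,\\[2mm] \dfrac{\sqrt{a^2-b^2}}{\cosh^{-1}(a/b)}, & a>b,\end{cases}$$ where $\cos^{-1}$ is the inverse cosine and $\cosh^{-1}(x)=\log(x+\sqrt{x^2-1})$ is the inverse hyperbolic cosine. The Neuman mean is $N(a,b)=\frac12\left(a+\frac{b^{2}}{SB(a,b)}\right)$, and $N_{AG}(a,b)=N(A(a,b),G(a,b))$ for $a\neq b$. *)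

(* Defs.v *)
From Stdlib Require Import Reals.
Open Scope R_scope.

Definition geom_mean (a b : R) : R := sqrt (a * b).

Definition arith_mean (a b : R) : R := (a + b) / 2.

Definition arcosh (x : R) : R := ln (x + sqrt (x ^ 2 - 1)).

(* Only meaningful for positive, distinct [a] and [b]; for [a = b] the second
   branch is taken and the value is irrelevant. *)
Definition schwab_borchardt (a b : R) : R :=
  if Rlt_dec a b
  then sqrt (b ^ 2 - a ^ 2) / acos (a / b)
  else sqrt (a ^ 2 - b ^ 2) / arcosh (a / b).

Definition neuman_mean (a b : R) : R :=
  (a + b ^ 2 / schwab_borchardt a b) / 2.

Definition N_AG (a b : R) : R :=
  neuman_mean (arith_mean a b) (geom_mean a b).

(* Main.v *)
From Stdlib Require Import Reals Lra Psatz.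
From Coquelicot Require Import Coquelicot.
Require Import Defs.
Open Scope R_scope.

(** Write [G] and [A] for the two means. Since [A > G > 0], there is [t > 0] with
    [A = G cosh t], and then [N_AG = G h(t)], where
    [h(t) = (cosh t + t / sinh t) / 2]. Everything is homogeneous, so [G] cancels
    and, with [c = cosh t], the theorem becomes the statement that

      [c^alpha3 < h < c^beta3]  and
      [alpha4 + (1 - alpha4)/c < 1/h < beta4 + (1 - beta4)/c]

    for all [t > 0] exactly for the given parameters
    ([bounds_iff_normalized]). Each side is monotone in its parameter because
    [c > 1], so sufficiency only needs the extreme values
    [1/3], [1], [0], [2/3].

    All estimates of [h] compare [t] with [sinh t * g(cosh t)] for an explicit
    [g]. As [cosh^2 - sinh^2 = 1], the derivative of that product is the function
    [c g(c) + (c^2 - 1) g'(c)] of [c] alone, and in the cases that occur its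
    difference with [1], the derivative of [t], is up to sign a square such as
    [(c - 1)^2] times something positive. This gives ([hyp_neuman_power_lower],
    [hyp_neuman_harmonic_lower], [hyp_neuman_upper])

      [c^(1/3) < h],  [3c/(2c + 1) < h],  [h < (3c^2 + 2c + 1)/(6c)].

    The first two are the sharp bounds for [1/3] and [2/3]; the last one gives
    [h < c], hence the bounds for [1] and [0].

    For necessity, [1/3] and [2/3] are forced by the behaviour as [t -> 0]: the
    rational upper bound for [h] agrees with [h] to second order there. The values
    [1] and [0] are forced by the behaviour at infinity, where [h > c/2] is
    enough. In each case an explicit value of [c] contradicts a parameter outside
    the range, so no limits are taken. *)

(** * Hyperbolic functions *)

(** The ratio [N_AG / G] as a function of [t], where [cosh t = A / G]. *)
Definition hyp_neuman (t : R) : R := (cosh t + t / sinh t) / 2.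

Lemma cosh_sinh_sq (t : R) : cosh t ^ 2 - sinh t ^ 2 = 1.
Proof.
  assert (H : exp t * exp (- t) = 1)
    by (rewrite <- exp_plus, Rplus_opp_r; apply exp_0).
  unfold cosh, sinh. nra.
Qed.

Lemma sinh_pos (t : R) : 0 < t -> 0 < sinh t.
Proof.
  intros Ht. assert (H : exp (- t) < exp t) by (apply exp_increasing; lra).
  unfold sinh; lra.
Qed.

Lemma cosh_gt_1 (t : R) : 0 < t -> 1 < cosh t.
Proof.
  intros Ht. pose proof (sinh_pos t Ht). pose proof (cosh_sinh_sq t).
  assert (0 < cosh t)
    by (unfold cosh; pose proof (exp_pos t); pose proof (exp_pos (- t)); lra).
  nra.
Qed.

Lemma cosh_arcosh (c : R) : 1 < c -> exists t, 0 < t /\ cosh t = c.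
Proof.
  intros Hc. exists (arcosh c).
  assert (Hs : 0 < sqrt (c ^ 2 - 1)) by (apply sqrt_lt_R0; nra).
  assert (Hs2 : sqrt (c ^ 2 - 1) * sqrt (c ^ 2 - 1) = c ^ 2 - 1) by (apply sqrt_sqrt; nra).
  unfold arcosh; split.
  - rewrite <- ln_1. apply ln_increasing; lra.
  - unfold cosh. rewrite exp_Ropp, exp_ln by lra.
    set (s := sqrt _) in *. field_simplify_eq; [nra | lra].
Qed.

Lemma arcosh_cosh (t : R) : 0 < t -> arcosh (cosh t) = t.
Proof.
  intros Ht. unfold arcosh.
  replace (cosh t ^ 2 - 1) with (sinh t * sinh t) by (pose proof (cosh_sinh_sq t); lra).
  rewrite sqrt_square by (left; exact (sinh_pos t Ht)).
  replace (cosh t + sinh t) with (exp t) by (unfold cosh, sinh; lra).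
  apply ln_exp.
Qed.

(** * The means in hyperbolic form *)

(** With [a = g cosh t > g] the Schwab-Borchardt mean takes its second branch and
    equals [g sinh t / t]. *)
Lemma neuman_mean_cosh (g t : R) :
  0 < g -> 0 < t -> neuman_mean (g * cosh t) g = g * hyp_neuman t.
Proof.
  intros Hg Ht.
  pose proof (cosh_gt_1 t Ht); pose proof (sinh_pos t Ht).
  unfold neuman_mean, schwab_borchardt, hyp_neuman.
  destruct (Rlt_dec (g * cosh t) g) as [Hlt | _]; [nra |].
  replace (g * cosh t / g) with (cosh t) by (field; lra).
  rewrite arcosh_cosh by exact Ht.
  replace ((g * cosh t) ^ 2 - g ^ 2) with ((g * sinh t) * (g * sinh t))
    by (pose proof (cosh_sinh_sq t); nra).
  rewrite sqrt_square by nra.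
  field; lra.
Qed.

Lemma means_of_exp (m t : R) :
  geom_mean (exp (m + t)) (exp (m - t)) = exp m /\
  arith_mean (exp (m + t)) (exp (m - t)) = exp m * cosh t.
Proof.
  split.
  - unfold geom_mean. rewrite <- exp_plus.
    replace (m + t + (m - t)) with (m + m) by ring.
    rewrite exp_plus. apply sqrt_square. left; apply exp_pos.
  - unfold arith_mean, cosh, Rminus. rewrite !exp_plus. field.
Qed.

Lemma means_sym (a b : R) :
  geom_mean a b = geom_mean b a /\ arith_mean a b = arith_mean b a.
Proof.
  split.
  - unfold geom_mean. now rewrite Rmult_comm.
  - unfold arith_mean. now rewrite Rplus_comm.
Qed.

(** For [a > b] the parameter is [t = (ln a - ln b) / 2], because
    [a = G exp t] and [b = G exp (- t)]; the case [a < b] follows by symmetry. *)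
Lemma means_hyperbolic (a b : R) :
  0 < a -> 0 < b -> a <> b ->
  exists t, 0 < t /\ 0 < geom_mean a b /\
    arith_mean a b = geom_mean a b * cosh t /\
    N_AG a b = geom_mean a b * hyp_neuman t.
Proof.
  assert (Hord : forall a b, 0 < b < a ->
    exists t, 0 < t /\ 0 < geom_mean a b /\
      arith_mean a b = geom_mean a b * cosh t).
  { intros x y [Hy Hxy].
    exists ((ln x - ln y) / 2).
    pose proof (ln_increasing y x Hy Hxy).
    destruct (means_of_exp ((ln x + ln y) / 2) ((ln x - ln y) / 2)) as [HG HA].
    replace ((ln x + ln y) / 2 + (ln x - ln y) / 2) with (ln x) in HG, HA by field.
    replace ((ln x + ln y) / 2 - (ln x - ln y) / 2) with (ln y) in HG, HA by field.
    rewrite !exp_ln in HG, HA by lra.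
    rewrite HG, HA. repeat split; [lra | apply exp_pos]. }
  intros Ha Hb Hab.
  assert (Hex : exists t, 0 < t /\ 0 < geom_mean a b /\
      arith_mean a b = geom_mean a b * cosh t).
  { destruct (Rtotal_order a b) as [H | [H | H]]; [| lra | apply Hord; lra].
    destruct (means_sym a b) as [-> ->]. apply Hord; lra. }
  destruct Hex as (t & Ht & HG & HA).
  exists t. repeat split; trivial.
  unfold N_AG. rewrite HA. now apply neuman_mean_cosh.
Qed.

(** * Comparing t with multiples of sinh t *)

Lemma pos_of_derive_pos (f df : R -> R) :
  f 0 = 0 ->
  (forall t, 0 <= t -> is_derive f t (df t)) ->
  (forall t, 0 < t -> 0 < df t) ->
  forall t, 0 < t -> 0 < f t.
Proof.
  intros H0 Hd Hpos t Ht.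
  destruct (MVT_cor2 f df 0 t Ht) as (x & Hx & Hx0 & _).
  { intros x [Hx _]. apply is_derive_Reals. now apply Hd. }
  pose proof (Hpos x Hx0). nra.
Qed.

Lemma is_derive_cosh (t : R) : is_derive cosh t (sinh t).
Proof. apply is_derive_Reals, derivable_pt_lim_cosh. Qed.

Lemma is_derive_sinh (t : R) : is_derive sinh t (cosh t).
Proof. apply is_derive_Reals, derivable_pt_lim_sinh. Qed.

Lemma is_derive_sinh_mult (g : R -> R) (dg t : R) :
  is_derive g (cosh t) dg ->
  is_derive (fun x => sinh x * g (cosh x)) t
    (cosh t * g (cosh t) + (cosh t ^ 2 - 1) * dg).
Proof.
  intros Hg.
  replace (cosh t ^ 2 - 1) with (sinh t * sinh t) by (pose proof (cosh_sinh_sq t); lra).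
  replace (cosh t * g (cosh t) + sinh t * sinh t * dg)
    with (plus (mult (cosh t) (g (cosh t))) (mult (sinh t) (scal (sinh t) dg)))
    by (unfold plus, mult, scal; simpl; unfold mult; simpl; ring).
  apply (is_derive_mult sinh (fun x => g (cosh x))).
  - apply is_derive_sinh.
  - apply (is_derive_comp g cosh); [exact Hg | apply is_derive_cosh].
  - intros; apply Rmult_comm.
Qed.

(** The two sides agree at [0], and the left side of the hypothesis on [g] is the
    derivative of [sinh t * g (cosh t)] written in [c = cosh t], so a calculus
    inequality in [t] is reduced to an algebraic one in [c]. The constant [k]
    allows [k = -1] with [- g] in place of [g], which gives upper bounds for [t]. *)
Lemma sinh_mult_lt (g dg : R -> R) (k : R) :
  (forall c, 1 <= c -> is_derive g c (dg c)) ->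
  (forall c, 1 < c -> c * g c + (c ^ 2 - 1) * dg c < k) ->
  forall t, 0 < t -> sinh t * g (cosh t) < k * t.
Proof.
  intros Hd Hlt t Ht.
  apply Rlt_0_minus.
  apply (pos_of_derive_pos (fun x => k * x - sinh x * g (cosh x))
    (fun x => k - (cosh x * g (cosh x) + (cosh x ^ 2 - 1) * dg (cosh x)))).
  - rewrite sinh_0; ring.
  - intros x Hx. apply (is_derive_minus (fun y : R => k * y)).
    + auto_derive; [trivial | ring].
    + apply is_derive_sinh_mult, Hd.
      destruct Hx as [Hx | <-]; [left; now apply cosh_gt_1 | rewrite cosh_0; lra].
  - intros x Hx. pose proof (Hlt _ (cosh_gt_1 x Hx)). lra.
  - exact Ht.
Qed.

(** A weakening of the Lazarevic inequality [t / sinh t < c^(-1/3)] by the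
    arithmetic-geometric inequality [c^(-1/3) <= (1 + 1 + 1/c) / 3]. It is still exact to
    second order at [t = 0], which is what the sharpness of [1/3] and [2/3]
    requires. *)
Lemma id_lt_sinh_mult (t : R) :
  0 < t -> t < sinh t * ((2 * cosh t + 1) / (3 * cosh t)).
Proof.
  intros Ht.
  enough (H : sinh t * (- ((2 * cosh t + 1) / (3 * cosh t))) < - 1 * t) by lra.
  apply (sinh_mult_lt (fun c => - ((2 * c + 1) / (3 * c)))
    (fun c => 1 / (3 * c ^ 2))); trivial.
  - intros c Hc. auto_derive; [lra | field; lra].
  - intros c Hc. apply Rlt_0_minus.
    replace (- 1 - _) with ((c - 1) ^ 2 * (2 * c + 1) / (3 * c ^ 2))
      by (field; lra).
    apply Rdiv_lt_0_compat; [apply Rmult_lt_0_compat |]; nra.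
Qed.

(** [3 c / (2 c + 1) < h(t)] solved for [t]. *)
Lemma sinh_mult_harmonic_lt_id (t : R) :
  0 < t -> sinh t * (cosh t * (5 - 2 * cosh t) / (2 * cosh t + 1)) < t.
Proof.
  intros Ht. apply Rlt_le_trans with (1 * t); [| lra].
  apply (sinh_mult_lt (fun c => c * (5 - 2 * c) / (2 * c + 1))
    (fun c => - 1 + 6 / (2 * c + 1) ^ 2)); trivial.
  - intros c Hc. auto_derive; [lra | field; lra].
  - intros c Hc. apply Rlt_0_minus.
    replace (1 - _) with
      ((c - 1) ^ 2 * (8 * c ^ 2 + 12 * c + 6) / (2 * c + 1) ^ 2) by (field; lra).
    apply Rdiv_lt_0_compat; [apply Rmult_lt_0_compat |]; nra.
Qed.

(** [c^(1/3) < h(t)] solved for [t]. In terms of [u = c^(1/3)] the derivative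
    condition is polynomial: with [v = u^2] it reduces to
    [3 v^4 - 4 v^3 + 1 = (v - 1)^2 (3 v^2 + 2 v + 1) > 0]. *)
Lemma sinh_mult_power_lt_id (t : R) :
  0 < t -> sinh t * (2 * Rpower (cosh t) (1 / 3) - cosh t) < t.
Proof.
  intros Ht. apply Rlt_le_trans with (1 * t); [| lra].
  apply (sinh_mult_lt (fun c => 2 * Rpower c (1 / 3) - c)
    (fun c => 2 * (Rpower c (1 / 3) / (3 * c)) - 1)); trivial.
  - intros c Hc. unfold Rpower. auto_derive; [lra | field; lra].
  - intros c Hc.
    assert (Hu3 : Rpower c (1 / 3) ^ 3 = c).
    { rewrite <- Rpower_pow by apply exp_pos. rewrite Rpower_mult.
      replace (1 / 3 * INR 3) with 1 by (simpl; field).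
      apply Rpower_1; lra. }
    assert (Hu : 1 < Rpower c (1 / 3)).
    { pose proof (Rpower_lt c 0 (1 / 3) Hc) as H.
      rewrite Rpower_O in H by lra. lra. }
    set (u := Rpower c (1 / 3)) in *. clearbody u. subst c.
    apply Rlt_0_minus.
    replace (1 - _) with
      ((u ^ 2 - 1) ^ 2 * (3 * u ^ 4 + 2 * u ^ 2 + 1) * (2 / 3) / u ^ 2)
      by (field; lra).
    assert (1 < u ^ 2) by nra.
    apply Rdiv_lt_0_compat; [| lra].
    repeat apply Rmult_lt_0_compat; nra.
Qed.

(** * Bounds for the normalized Neuman mean *)

Lemma hyp_neuman_gt_half_cosh (t : R) : 0 < t -> cosh t / 2 < hyp_neuman t.
Proof.
  intros Ht. unfold hyp_neuman.
  pose proof (Rdiv_lt_0_compat t (sinh t) Ht (sinh_pos t Ht)). lra.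
Qed.

Lemma hyp_neuman_upper (t : R) :
  0 < t ->
  hyp_neuman t < (3 * cosh t ^ 2 + 2 * cosh t + 1) / (6 * cosh t).
Proof.
  intros Ht. pose proof (sinh_pos t Ht) as Hs. pose proof (cosh_gt_1 t Ht).
  pose proof (id_lt_sinh_mult t Ht) as H1. rewrite Rmult_comm in H1.
  apply (Rlt_div_l _ _ _ Hs) in H1.
  unfold hyp_neuman.
  replace (_ / (6 * cosh t)) with
    ((cosh t + (2 * cosh t + 1) / (3 * cosh t)) / 2) by (field; lra).
  lra.
Qed.

Lemma hyp_neuman_lt_cosh (t : R) : 0 < t -> hyp_neuman t < cosh t.
Proof.
  intros Ht. pose proof (cosh_gt_1 t Ht).
  apply (Rlt_trans _ _ _ (hyp_neuman_upper t Ht)).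
  apply Rlt_div_l; nra.
Qed.

Lemma hyp_neuman_power_lower (t : R) :
  0 < t -> Rpower (cosh t) (1 / 3) < hyp_neuman t.
Proof.
  intros Ht. pose proof (sinh_pos t Ht) as Hs.
  pose proof (sinh_mult_power_lt_id t Ht) as H1. rewrite Rmult_comm in H1.
  apply (Rlt_div_r _ _ _ Hs) in H1.
  unfold hyp_neuman. lra.
Qed.

Lemma hyp_neuman_harmonic_lower (t : R) :
  0 < t -> 3 * cosh t / (2 * cosh t + 1) < hyp_neuman t.
Proof.
  intros Ht. pose proof (sinh_pos t Ht) as Hs. pose proof (cosh_gt_1 t Ht).
  pose proof (sinh_mult_harmonic_lt_id t Ht) as H1. rewrite Rmult_comm in H1.
  apply (Rlt_div_r _ _ _ Hs) in H1.
  unfold hyp_neuman.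
  replace (3 * cosh t / _) with
    ((cosh t + cosh t * (5 - 2 * cosh t) / (2 * cosh t + 1)) / 2) by (field; lra).
  lra.
Qed.

(** * Reduction to one variable *)

Definition normalized_bounds (alpha3 beta3 alpha4 beta4 c h : R) : Prop :=
  (Rpower c alpha3 < h < Rpower c beta3) /\
  (alpha4 + (1 - alpha4) / c < 1 / h < beta4 + (1 - beta4) / c).

Lemma geometric_combination_scale (g c p : R) :
  0 < g -> 0 < c -> Rpower (g * c) p * Rpower g (1 - p) = g * Rpower c p.
Proof.
  intros Hg Hc. rewrite <- Rpower_mult_distr by assumption.
  rewrite (Rmult_comm (Rpower g p)), Rmult_assoc, <- Rpower_plus.
  replace (p + (1 - p)) with 1 by ring. rewrite Rpower_1 by exact Hg. ring.
Qed.

Lemma bounds_scale (alpha3 beta3 alpha4 beta4 g c h : R) :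
  0 < g -> 0 < c -> 0 < h ->
  ((Rpower (g * c) alpha3 * Rpower g (1 - alpha3)
      < g * h < Rpower (g * c) beta3 * Rpower g (1 - beta3)) /\
   (alpha4 / g + (1 - alpha4) / (g * c)
      < 1 / (g * h) < beta4 / g + (1 - beta4) / (g * c)))
  <-> normalized_bounds alpha3 beta3 alpha4 beta4 c h.
Proof.
  intros Hg Hc Hh. unfold normalized_bounds.
  rewrite !geometric_combination_scale by assumption.
  assert (Hcomb : forall p, p / g + (1 - p) / (g * c) = / g * (p + (1 - p) / c))
    by (intros; field; lra).
  rewrite !Hcomb.
  replace (1 / (g * h)) with (/ g * (1 / h)) by (field; lra).
  assert (Hcancel : forall k x y, 0 < k -> (k * x < k * y <-> x < y))
    by (intros; split; [now apply Rmult_lt_reg_l | now apply Rmult_lt_compat_l]).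
  rewrite !Hcancel by first [assumption | now apply Rinv_0_lt_compat].
  reflexivity.
Qed.

Lemma hyp_neuman_pos (t : R) : 0 < t -> 0 < hyp_neuman t.
Proof.
  intros Ht. pose proof (hyp_neuman_gt_half_cosh t Ht).
  pose proof (cosh_gt_1 t Ht). lra.
Qed.

Lemma bounds_iff_normalized (alpha3 beta3 alpha4 beta4 : R) :
  (forall a b : R, 0 < a -> 0 < b -> a <> b ->
     (Rpower (arith_mean a b) alpha3 * Rpower (geom_mean a b) (1 - alpha3)
        < N_AG a b
        < Rpower (arith_mean a b) beta3 * Rpower (geom_mean a b) (1 - beta3)) /\
     (alpha4 / geom_mean a b + (1 - alpha4) / arith_mean a b
        < 1 / N_AG a b
        < beta4 / geom_mean a b + (1 - beta4) / arith_mean a b))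
  <->
  (forall t, 0 < t ->
     normalized_bounds alpha3 beta3 alpha4 beta4 (cosh t) (hyp_neuman t)).
Proof.
  split.
  - intros H t Ht.
    pose proof (cosh_gt_1 t Ht). pose proof (hyp_neuman_pos t Ht).
    destruct (means_of_exp 0 t) as [HG HA].
    rewrite exp_0 in HG, HA.
    apply (bounds_scale _ _ _ _ 1); [lra .. |].
    rewrite <- neuman_mean_cosh by lra.
    assert (Hlt : exp (0 - t) < exp (0 + t)) by (apply exp_increasing; lra).
    specialize (H (exp (0 + t)) (exp (0 - t)) (exp_pos _) (exp_pos _)).
    unfold N_AG in H. rewrite HG, HA in H. apply H. lra.
  - intros H a b Ha Hb Hab.
    destruct (means_hyperbolic a b Ha Hb Hab) as (t & Ht & HG & -> & ->).
    pose proof (cosh_gt_1 t Ht). pose proof (hyp_neuman_pos t Ht).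
    apply bounds_scale; [lra .. |]. now apply H.
Qed.

(** * Necessity of the parameter ranges *)

(** From [exp x >= 1 + x] and [ln c >= 1 - 1/c]; unlike the Bernoulli inequality this
    also holds for exponents below [1], and it is exact to first order at
    [c = 1]. *)
Lemma Rpower_ge_tangent (c p : R) :
  1 < c -> 0 <= p -> 1 + p * ((c - 1) / c) <= Rpower c p.
Proof.
  intros Hc Hp.
  assert (Hln : (c - 1) / c <= ln c).
  { pose proof (exp_ineq1_le (- ln c)) as H.
    rewrite exp_Ropp, exp_ln in H by lra.
    replace ((c - 1) / c) with (1 - / c) by (field; lra). lra. }
  unfold Rpower. pose proof (exp_ineq1_le (p * ln c)). nra.
Qed.

(** After clearing denominators, the tangent bound for [c^p] is at least the
    rational upper bound for [h] when [(c - 1)(3c - 1) <= 6p(c - 1)]; equality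
    holds at [c = 2p + 1/3], which is greater than [1] exactly when
    [p > 1/3]. *)
Lemma power_lower_exponent_le (p : R) :
  (forall t, 0 < t -> Rpower (cosh t) p < hyp_neuman t) -> p <= 1 / 3.
Proof.
  intros H. apply Rnot_lt_le. intros Hp.
  destruct (cosh_arcosh (2 * p + 1 / 3)) as (t & Ht & Hc); [lra |].
  pose proof (H t Ht). pose proof (hyp_neuman_upper t Ht) as Hup.
  pose proof (Rpower_ge_tangent (cosh t) p (cosh_gt_1 t Ht)).
  enough (1 + p * ((cosh t - 1) / cosh t) =
    (3 * cosh t ^ 2 + 2 * cosh t + 1) / (6 * cosh t)) by lra.
  rewrite Hc. field. lra.
Qed.

(** For [p < 1], [c^p = c/2] at [c = 2^(1/(1 - p))], while [h > c/2]. *)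
Lemma power_upper_exponent_ge (p : R) :
  (forall t, 0 < t -> hyp_neuman t < Rpower (cosh t) p) -> 1 <= p.
Proof.
  intros H. apply Rnot_lt_le. intros Hp.
  assert (Hr : 0 < / (1 - p)) by (apply Rinv_0_lt_compat; lra).
  destruct (cosh_arcosh (Rpower 2 (/ (1 - p)))) as (t & Ht & Hc).
  { pose proof (Rpower_lt 2 0 (/ (1 - p))) as H2. rewrite Rpower_O in H2; lra. }
  pose proof (H t Ht) as Hlt. pose proof (hyp_neuman_gt_half_cosh t Ht).
  pose proof (cosh_gt_1 t Ht).
  enough (Rpower (cosh t) p = cosh t / 2) by lra.
  assert (H2 : Rpower (cosh t) (1 - p) = 2).
  { rewrite Hc, Rpower_mult. replace (/ (1 - p) * (1 - p)) with 1 by (field; lra).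
    apply Rpower_1; lra. }
  replace p with (1 + - (1 - p)) at 1 by ring.
  rewrite Rpower_plus, Rpower_Ropp, H2, Rpower_1 by lra. reflexivity.
Qed.

(** [1/h < 2/c], and for [w > 0] the lower bound [w + (1 - w)/c] equals [2/c] at
    [c = 1 + 1/w]. *)
Lemma harmonic_lower_weight_le (w : R) :
  (forall t, 0 < t -> w + (1 - w) / cosh t < 1 / hyp_neuman t) -> w <= 0.
Proof.
  intros H. apply Rnot_lt_le. intros Hw.
  pose proof (Rinv_0_lt_compat w Hw).
  destruct (cosh_arcosh (1 + / w)) as (t & Ht & Hc); [lra |].
  pose proof (H t Ht). pose proof (hyp_neuman_gt_half_cosh t Ht) as Hh.
  pose proof (cosh_gt_1 t Ht).
  assert (1 / hyp_neuman t < 1 / (cosh t / 2)).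
  { unfold Rdiv at 1 2. rewrite !Rmult_1_l. apply Rinv_lt_contravar; nra. }
  enough (w + (1 - w) / cosh t = 1 / (cosh t / 2)) by lra.
  rewrite Hc. field. split; [lra |].
  replace (w + 1) with (w * (1 + / w)) by (field; lra). nra.
Qed.

(** The reciprocal of the rational upper bound for [h] is at least
    [w + (1 - w)/c] when [w (3c^2 + 2c + 1) <= 3c + 1]. At [c = 1] this reads [6w <= 4], so for
    [w < 2/3] it persists for some [c > 1]. *)
Lemma harmonic_upper_weight_ge (w : R) :
  (forall t, 0 < t -> 1 / hyp_neuman t < w + (1 - w) / cosh t) -> 2 / 3 <= w.
Proof.
  intros H. apply Rnot_lt_le. intros Hw.
  (* The condition is monotone in [w]; a nonnegative [v] keeps the step
     [c - 1] at most [4/5]. *)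
  set (v := Rmax w 0).
  assert (Hv : w <= v /\ 0 <= v < 2 / 3)
    by (unfold v, Rmax; destruct (Rle_dec w 0); lra).
  clearbody v.
  (* With [c = 1 + e] the condition is [4 + 3e >= v (6 + 8e + 3e^2)]. For [e <= 1]
     the right side is at most [v (6 + 11e)], and [11v - 3 <= 5], so
     [e = (4 - 6v)/5] is small enough. *)
  destruct (cosh_arcosh (1 + (4 - 6 * v) / 5)) as (t & Ht & Hc); [lra |].
  pose proof (H t Ht) as Hlt. pose proof (hyp_neuman_upper t Ht) as Hup.
  pose proof (hyp_neuman_pos t Ht).
  set (c := cosh t) in *.
  assert (1 < c) by (unfold c; now apply cosh_gt_1).
  assert (Hrecip : 6 * c / (3 * c ^ 2 + 2 * c + 1) < 1 / hyp_neuman t).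
  { replace (6 * c / _) with (/ ((3 * c ^ 2 + 2 * c + 1) / (6 * c)))
      by (field; split; nra).
    unfold Rdiv at 2. rewrite Rmult_1_l. apply Rinv_lt_contravar; nra. }
  assert (Hcomb : w + (1 - w) / c <= 6 * c / (3 * c ^ 2 + 2 * c + 1)).
  { apply Rminus_le_0.
    replace (_ - _) with
      ((c - 1) * (3 * c + 1 - w * (3 * c ^ 2 + 2 * c + 1)) /
       (c * (3 * c ^ 2 + 2 * c + 1))) by (field; split; nra).
    assert (Hmono : w * (3 * c ^ 2 + 2 * c + 1) <= v * (3 * c ^ 2 + 2 * c + 1))
      by (apply Rmult_le_compat_r; nra).
    assert (Hv2 : v * (3 * c ^ 2 + 2 * c + 1) <= 3 * c + 1).
    { rewrite Hc. set (e := (4 - 6 * v) / 5).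
      assert (He : v = (4 - 5 * e) / 6 /\ 0 <= e <= 4 / 5) by (unfold e; lra).
      clear - He. clearbody e. destruct He as [-> He]. nra. }
    apply Rdiv_le_0_compat; [apply Rmult_le_pos |]; nra. }
  lra.
Qed.

Lemma harmonic_combination_mono (c v w : R) :
  1 < c -> v <= w -> v + (1 - v) / c <= w + (1 - w) / c.
Proof.
  intros Hc Hvw. apply Rminus_le_0.
  replace (_ - _) with ((w - v) * (c - 1) / c) by (field; lra).
  apply Rdiv_le_0_compat; nra.
Qed.

(** * The characterization *)

Theorem theorem3p2 (alpha3 beta3 alpha4 beta4 : R) :
  (forall a b : R, 0 < a -> 0 < b -> a <> b ->
     (Rpower (arith_mean a b) alpha3 * Rpower (geom_mean a b) (1 - alpha3)
        < N_AG a b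
        < Rpower (arith_mean a b) beta3 * Rpower (geom_mean a b) (1 - beta3)) /\
     (alpha4 / geom_mean a b + (1 - alpha4) / arith_mean a b
        < 1 / N_AG a b
        < beta4 / geom_mean a b + (1 - beta4) / arith_mean a b))
  <->
  (alpha3 <= 1 / 3 /\ 1 <= beta3 /\ alpha4 <= 0 /\ 2 / 3 <= beta4).
Proof.
  rewrite bounds_iff_normalized. unfold normalized_bounds. split.
  - intros H. repeat split.
    + apply power_lower_exponent_le. intros t Ht. apply (H t Ht).
    + apply power_upper_exponent_ge. intros t Ht. apply (H t Ht).
    + apply harmonic_lower_weight_le. intros t Ht. apply (H t Ht).
    + apply harmonic_upper_weight_ge. intros t Ht. apply (H t Ht).
  - intros (Ha3 & Hb3 & Ha4 & Hb4) t Ht.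
    pose proof (cosh_gt_1 t Ht) as Hc. pose proof (hyp_neuman_pos t Ht).
    pose proof (hyp_neuman_lt_cosh t Ht) as Hlt.
    repeat split.
    + apply Rle_lt_trans with (2 := hyp_neuman_power_lower t Ht).
      apply Rle_Rpower; lra.
    + apply Rlt_le_trans with (1 := Hlt).
      rewrite <- (Rpower_1 (cosh t)) at 1 by lra. apply Rle_Rpower; lra.
    + apply Rle_lt_trans with (1 := harmonic_combination_mono _ _ _ Hc Ha4).
      replace (0 + (1 - 0) / cosh t) with (/ cosh t) by (field; lra).
      unfold Rdiv. rewrite Rmult_1_l. apply Rinv_lt_contravar; nra.
    + apply Rlt_le_trans with (2 := harmonic_combination_mono _ _ _ Hc Hb4).
      replace (2 / 3 + (1 - 2 / 3) / cosh t)
        with (/ (3 * cosh t / (2 * cosh t + 1))) by (field; lra).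
      unfold Rdiv at 1. rewrite Rmult_1_l.
      apply Rinv_lt_contravar; [| now apply hyp_neuman_harmonic_lower].
      apply Rmult_lt_0_compat; [apply Rdiv_lt_0_compat |]; lra.
Qed.
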